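(* Let $\mathcal{G}$ be a multiple-unicasts network with $k$ sources and $m$ links, and let $G$ be the digraph on $m$ vertices constructed from $\mathcal{G}$ (as defined in the context). Then $$m-\mathrm{MAIS}(G)\;\le\;\mathrm{GNSCUT}(\mathcal{G}).$$
   Context: **Multiple-unicasts (MU) network.** A finite acyclic directed network $\mathcal{G}(\mathcal{V},\mathcal{E})$ (parallel links allowed), where every link $e\in\mathcal{E}$ has unit capacity and is directed from its tail $t(e)$ to its head $h(e)$. There are $k$ source nodes $s_1,\dots,s_k$ and $k$ destination nodes $t_1,\dots,t_k$. For each $i$ there is a set $\mathcal{E}_i\subset\mathcal{E}$ of exactly $\mathrm{mincut}(s_i,t_i)$ *source links* of $s_i$, which have head $s_i$ and no tail; $\mathrm{mincut}(s_i,t_i)$ is the minimum number of unit-capacity links separating $t_i$ from $s_i$. All links not in $\bigcup_i\mathcal{E}_i$ have a tail and a head. $m=|\mathcal{E}|$ counts all links, including source links. **The digraph $G$.** Let $\mathcal{G}'$ be the network obtained from $\mathcal{G}$ by setting $t(e)=t_i$ for all $e\in\mathcal{E}_i$, $i=1,\dots,k$. $G$ is the reversed line graph of $\mathcal{G}'$: its vertices are the $m$ links of $\mathcal{G}'$, and there is a directed edge from $e$ to $\hat e$ iff $h(\hat e)=t(e)$ in $\mathcal{G}'$. **MAIS.** $\mathrm{MAIS}(G)$ is the cardinality of the largest $\widehat V\subseteq V(G)$ such that the subgraph of $G$ induced by $\widehat V$ has no directed cycle. **GNS cut.** A GNS (Generalized Network Sharing) cut of $\mathcal{G}$ is a subset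 $S\subset\mathcal{E}$ such that for $\mathcal{G}-S$ (the network with the links in $S$ removed) there is a permutation $\pi:[k]\to[k]$ such that for all $i,j\in[k]$, if $\pi(i)\ge\pi(j)$ then there is no path from $s_i$ to $t_j$ in $\mathcal{G}-S$. $\mathrm{GNSCUT}(\mathcal{G})$ is the smallest capacity (number of unit-capacity links) of a GNS cut of $\mathcal{G}$. *)

(* Defs.v *)
From HB Require Import structures.
From mathcomp Require Import all_fingroup.
From mathcomp Require Import all_boot.

Set Implicit Arguments.
Unset Strict Implicit.
Unset Printing Implicit Defensive.

(* A directed cycle is a nonempty closed walk through pairwise distinct
   vertices, so a bound on its length can be built in; self-loops are cycles
   of length 1. *)
Definition acyclic (T : finType) (r : rel T) : bool :=
  [forall n : 'I_#|T|, forall p : n.+1.-tuple T, ~~ ucycleb r p].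

Lemma acyclicP (T : finType) (r : rel T) :
  reflect (forall p : seq T, cycle r p -> p = [::]) (acyclic r).
Proof.
apply: (iffP forallP) => [acr p | acr n]; last first.
  apply/forallP => p; apply/negP => /andP[/acr p0 _].
  by have := size_tuple p; rewrite p0.
case: p => [//|x p] /=; rewrite rcons_path => /andP[rxp rpx].
case/shortenP: rxp rpx => p' rxp' Up' _ rpx'.
have sz : size p' < #|T|.
  by have := max_card (mem (x :: p')); rewrite (card_uniqP Up').
have /forallP/(_ (in_tuple (x :: p')))/negP[] := acr (Ordinal sz).
by apply/andP; split; rewrite //= rcons_path rxp'.
Qed.

Definition induced (T : finType) (r : rel T) (W : {set T}) : rel T :=
  [rel x y | [&& x \in W, y \in W & r x y]].

Definition MAIS (T : finType) (r : rel T) : nat :=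
  \max_(W : {set T} | acyclic (induced r W)) #|W|.

(* The least cardinality of a set satisfying P, with value #|T| if no set
   does. *)
Definition min_card (T : finType) (P : pred {set T}) : nat :=
  #|[arg min_(S < setT | P S) #|S|]|.

Lemma min_cardP (T : finType) (P : pred {set T}) (S0 : {set T}) :
  P S0 ->
  (exists2 S, P S & #|S| = min_card P) /\ (forall S, P S -> min_card P <= #|S|).
Proof.
move=> PS0; rewrite /min_card /arg_min /extremum.
case: pickP => [S /= /andP[PS /forallP minS] | noS].
  split=> [|S' PS']; first by exists S.
  by have := minS S'; rewrite PS'.
case: (arg_minnP (fun S : {set T} => #|S|) PS0) => S PS minS.
have /negP[] := negbT (noS S); rewrite /= PS /=.
by apply/forallP => S'; apply/implyP => /minS.
Qed.

Record network := Network {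
  node : finType;
  link : finType;
  tail : link -> option node;
  head : link -> node
}.

Arguments tail : clear implicits.
Arguments head : clear implicits.

(* One step along some link outside S; paths in the network with S removed are
   given by [connect (step N S)], so every node reaches itself. *)
Definition step (N : network) (S : {set link N}) : rel (node N) :=
  [rel u v | [exists e, [&& e \notin S, tail N e == Some u & head N e == v]]].

Arguments step : clear implicits.

Definition mincut (N : network) (u v : node N) : nat :=
  min_card [pred S | ~~ connect (step N S) u v].

(* [src_neq_dst] is what makes mincut(s_i, t_i) meaningful, and
   [src_links_disjoint] what makes the rule "t(e) := t_i for e in E_i"
   unambiguous; the latter is automatic when the sources are distinct.  No
   other distinctness of the sources and destinations is assumed. *)
Record mu_network (k : nat) := MUNetwork {
  net :> network;
  net_acyclic : acyclic (step net set0);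
  src : 'I_k -> node net;
  dst : 'I_k -> node net;
  src_neq_dst : forall i, src i != dst i;
  src_links : 'I_k -> {set link net};
  card_src_links : forall i, #|src_links i| = mincut (src i) (dst i);
  src_links_disjoint :
    forall i j, i != j -> [disjoint src_links i & src_links j];
  src_links_head : forall i e, e \in src_links i -> head net e = src i;
  src_links_tail : forall i e, e \in src_links i -> tail net e = None;
  other_links_tail :
    forall e, (forall i, e \notin src_links i) -> tail net e != None
}.

Definition closed_tail (k : nat) (N : mu_network k) (e : link N) :
    option (node N) :=
  if [pick i | e \in src_links N i] is Some i then Some (dst N i)
  else tail N e.

Arguments closed_tail {k} N e.

Definition closed_network (k : nat) (N : mu_network k) : network :=
  @Network (node N) (link N) (closed_tail N) (head N).

(* The edge e -> e' requires the head of e' to be the tail of e: the line graph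
   is reversed. *)
Definition rev_line_graph (N : network) : rel (link N) :=
  [rel e e' | Some (head N e') == tail N e].

Arguments rev_line_graph : clear implicits.

Definition mu_digraph (k : nat) (N : mu_network k) : rel (link N) :=
  rev_line_graph (closed_network N).

Arguments mu_digraph {k} N.

Definition gns_cut (k : nat) (N : mu_network k) (S : {set link N}) : bool :=
  [exists pi : 'S_k, forall i : 'I_k, forall j : 'I_k,
     (pi j <= pi i) ==> ~~ connect (step N S) (src N i) (dst N j)].

Arguments gns_cut {k} N S.

(* If some source-destination coincidences s_i = t_j rule out every GNS cut,
   the value is the number of links, by the convention of [min_card]. *)
Definition GNSCUT (k : nat) (N : mu_network k) : nat :=
  min_card (gns_cut N).

(* Main.v *)
Require Import Defs.
From HB Require Import structures.
From mathcomp Require Import perm.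
From mathcomp Require Import all_boot.

(** The complement of a GNS cut [S] induces an acyclic subgraph of [G].  A
    cycle avoiding the source links reverses to a cycle of the network.  Otherwise
    follow the cycle from a source link of [s_i]: every link reached has a head
    from which some [t_j] with [pi j <= pi i] is reachable outside [S], since
    passing a source link of [s_l] replaces [j] by an [l] with [pi l < pi j].
    Back at the start this gives a forbidden path from [s_i] to [t_j]. *)

Set Implicit Arguments.
Unset Strict Implicit.
Unset Printing Implicit Defensive.

Lemma path_invariant (T : eqType) (r : rel T) (P : T -> Prop) x p :
  (forall y z, r y z -> P y -> P z) -> path r x p -> P x -> P (last x p).
Proof.
by move=> rP; elim: p x => //= y p IHp x /andP[/rP xy /IHp yp] /xy.
Qed.

Section MUNetwork.

Variables (k : nat) (N : mu_network k).
Implicit Types (S W : {set link N}) (e : link N).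

Variant closed_tail_spec e : option (node N) -> Prop :=
| ClosedTailSrc i of e \in src_links N i : closed_tail_spec e (Some (dst N i))
| ClosedTailLink of (forall i, e \notin src_links N i) :
    closed_tail_spec e (tail N e).

Lemma closed_tailP e : closed_tail_spec e (closed_tail N e).
Proof.
rewrite /closed_tail; case: pickP => [i | noi]; first exact: ClosedTailSrc.
by apply: ClosedTailLink => i; rewrite noi.
Qed.

(** Disjointness of the sets of source links forces [pick] to return [i] itself. *)
Lemma closed_tail_src e i :
  e \in src_links N i -> closed_tail N e = Some (dst N i).
Proof.
move=> ei; case: closed_tailP => [j ej | /(_ i)]; last by rewrite ei.
have [-> // | nij] := eqVneq i j.
by have /pred0P/(_ e) := src_links_disjoint N nij; rewrite /= ei ej.
Qed.

Lemma mu_digraphE e e' :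
  mu_digraph N e e' = (Some (Defs.head N e') == closed_tail N e).
Proof. by []. Qed.

Lemma step_link S e v :
  e \notin S -> tail N e = Some v -> step N S v (Defs.head N e).
Proof. by move=> eS te; apply/existsP; exists e; rewrite eS te !eqxx. Qed.

Lemma cycle_has_src_link W p :
    cycle (induced (mu_digraph N) W) p -> p != [::] ->
  exists i, exists2 e, e \in p & e \in src_links N i.
Proof.
move=> cyc p_neq0.
have [/hasP[e ep /existsP[i ei]] | /hasPn no_src] :=
  boolP (has (fun e => [exists i, e \in src_links N i]) p).
  by exists i, e.
(* An edge from [e] to [e'] makes [e] itself a link from the head of [e'] to the head of [e], so the
   heads along [p] go round against the links. *)
have cyc' : cycle (fun u v => step N set0 v u) (map (Defs.head N) p).
  rewrite cycle_map; apply: (sub_in_cycle (P := mem p)) cyc; last exact/allP.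
  move=> e e' ep _ /and3P[_ _]; rewrite mu_digraphE; have noe := no_src e ep.
  case: closed_tailP => [i ei | _ /eqP/esym te].
    by case/negP: noe; apply/existsP; exists i.
  by apply: step_link; rewrite ?in_set0.
rewrite -rev_cycle in cyc'.
have /acyclicP/(_ _ cyc')/(congr1 size) := net_acyclic N.
by rewrite size_rev size_map; case: p p_neq0 {cyc no_src cyc'}.
Qed.

Lemma gns_cut_acyclic S :
  gns_cut N S -> acyclic (induced (mu_digraph N) (~: S)).
Proof.
case/existsP=> pi /forallP cutS; apply/acyclicP => p cyc.
have cut i j : connect (step N S) (src N i) (dst N j) -> pi i < pi j.
  move=> cij; rewrite ltnNge; apply: contraL cij => le_ji.
  by have /forallP/(_ j)/implyP := cutS i; apply.
apply/eqP/negP => /negP/(cycle_has_src_link cyc)[i [x /rot_to[n q def_p] xi]].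
pose reach y :=
  exists2 j, pi j <= pi i & connect (step N S) (Defs.head N y) (dst N j).
have reach_step y z :
    induced (mu_digraph N) (~: S) y z -> reach y -> reach z.
  case/and3P; rewrite !in_setC mu_digraphE => yS _.
  case: closed_tailP => [l yl /eqP[hz] | _ /eqP/esym ty] [j le_ji yj].
    exists l; last by rewrite hz.
    rewrite (src_links_head yl) in yj.
    exact: leq_trans (ltnW (cut _ _ yj)) le_ji.
  (* The link [y] lies outside [S] and leads from the head of [z] to the head of [y]: it extends the
     path backwards. *)
  exists j => //; apply: connect_trans yj.
  by apply: connect1; apply: step_link.
have [j le_ji] : reach x.
  suff: reach (last x (rcons q x)) by rewrite last_rcons.
  (* The first edge is split off, as [reach x] is the goal. Its end has head [dst N i], hence
     satisfies [reach] with [j = i] and the empty path. [headI] also covers a self-loop, where [q]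
     is empty. *)
  move: cyc; rewrite -(rot_cycle n) def_p /= headI /=.
  case/andP=> /and3P[_ _]; rewrite mu_digraphE (closed_tail_src xi).
  move=> /eqP[hy] cyc_y.
  by apply: path_invariant reach_step cyc_y _; exists i; rewrite ?hy.
by rewrite (src_links_head xi) => /cut; rewrite ltnNge le_ji.
Qed.

End MUNetwork.

Theorem theorem3 (k : nat) (N : mu_network k) :
  #|link N| - MAIS (mu_digraph N) <= GNSCUT N.
Proof.
rewrite /GNSCUT; have [S0 cutS0 | no_cut] := pickP (gns_cut N).
  have [[S cutS <-] _] := min_cardP cutS0.
  rewrite leq_subLR addnC -(cardsC S) leq_add2l.
  exact: (leq_bigmax_cond (~: S) (gns_cut_acyclic cutS)).
(* Without any GNS cut, [GNSCUT N] is the number of links. *)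
rewrite /min_card /arg_min /extremum.
case: pickP => [S /= /andP[] | _]; first by rewrite no_cut.
by rewrite cardsT leq_subr.
Qed.
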